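(* Let $H\ge 1$, $r,m\ge 1$, $d=(H+1)r+Hm$, and let $\widetilde{\mathbf{a}}_{\varphi_1}:\mathbb{R}^d\to\mathbb{R}^r$ and $\widetilde{\mathbf{B}}_{\varphi_2}:\mathbb{R}^d\to\mathbb{R}^{r\times m}$ be maps. With the extended state $\boldsymbol{\xi}_k$ and the maps $\boldsymbol{\alpha}:\mathbb{R}^d\to\mathbb{R}^d$, $\boldsymbol{\beta}:\mathbb{R}^d\to\mathbb{R}^{d\times m}$ defined in the context, the extended state transition $$\boldsymbol{\xi}_{k+1}=\boldsymbol{\alpha}(\boldsymbol{\xi}_k)+\boldsymbol{\beta}(\boldsymbol{\xi}_k)\,\mathbf{u}_k$$ constitutes a control-affine representation of the sequence-based dynamics $\mathbf{z}_{k+1}=\widetilde{\mathbf{a}}_{\varphi_1}(\boldsymbol{\xi}_k)+\widetilde{\mathbf{B}}_{\varphi_2}(\boldsymbol{\xi}_k)\mathbf{u}_k$. That is, $\boldsymbol{\alpha}$ and $\boldsymbol{\beta}$ depend only on $\boldsymbol{\xi}_k$ (so the transition is affine in $\mathbf{u}_k$), and whenever $\mathbf{z}_{k+1}=\widetilde{\mathbf{a}}_{\varphi_1}(\boldsymbol{\xi}_k)+\widetilde{\mathbf{B}}_{\varphi_2}(\boldsymbol{\xi}_k)\mathbf{u}_k$, the vector $\boldsymbol{\alpha}(\boldsymbol{\xi}_k)+\boldsymbol{\beta}(\boldsymbol{\xi}_k)\mathbf{u}_k$ equals the extended state at the next time step, $$\boldsymbol{\xi}_{k+1}=[\mathbf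{z}_{k-H+1}^T,\dots,\mathbf{z}_{k}^T,\mathbf{u}_{k-H+1}^T,\dots,\mathbf{u}_{k}^T,\mathbf{z}_{k+1}^T]^T.$$
   Context: Latent states are $\mathbf{z}_j\in\mathbb{R}^r$ and inputs are $\mathbf{u}_j\in\mathbb{R}^m$. For a history length $H$, the extended state vector is $$\boldsymbol{\xi}_k=[\mathbf{z}_{k-H}^T,\dots,\mathbf{z}_{k-1}^T,\mathbf{u}_{k-H}^T,\dots,\mathbf{u}_{k-1}^T,\mathbf{z}_k^T]^T\in\mathbb{R}^d,\qquad d=(H+1)r+Hm.$$ The maps $\boldsymbol{\alpha}$ and $\boldsymbol{\beta}$ are $$\boldsymbol{\alpha}(\boldsymbol{\xi}_k)=\mathbf{S}\boldsymbol{\xi}_k+\begin{bmatrix}\mathbf{0}_{Hr+Hm}\\ \widetilde{\mathbf{a}}_{\varphi_1}(\boldsymbol{\xi}_k)\end{bmatrix},\qquad \boldsymbol{\beta}(\boldsymbol{\xi}_k)=\begin{bmatrix}\mathbf{0}_{Hr\times m}\\ \mathbf{0}_{(H-1)m\times m}\\ \mathbf{I}_{m\times m}\\ \widetilde{\mathbf{B}}_{\varphi_2}(\boldsymbol{\xi}_k)\end{bmatrix}.$$ Here $\mathbf{S}\in\mathbb{R}^{d\times d}$ is the block-shift matrix that advances the memory sequences by one time step; with respect to the partition of $\boldsymbol{\xi}_k$ into state history (size $Hr$), input history (size $Hm$) and current state (size $r$), $$\mathbf{S}=\begin{bmatrix}\mathbf{S}_z&\mathbf{0}_{Hr\times Hm}&\mathbf{E}_z\\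 \mathbf{0}_{Hm\times Hr}&\mathbf{S}_u&\mathbf{0}_{Hm\times r}\\ \mathbf{0}_{r\times Hr}&\mathbf{0}_{r\times Hm}&\mathbf{0}_{r\times r}\end{bmatrix},$$ where $\mathbf{S}_z\in\mathbb{R}^{Hr\times Hr}$ and $\mathbf{S}_u\in\mathbb{R}^{Hm\times Hm}$ are block matrices with $H\times H$ blocks having identity blocks ($\mathbf{I}_{r\times r}$, respectively $\mathbf{I}_{m\times m}$) on the first block superdiagonal and zeros elsewhere, and $\mathbf{E}_z\in\mathbb{R}^{Hr\times r}$ has $\mathbf{I}_{r\times r}$ in its bottom block row and zeros elsewhere. *)

(* Defs.v *)
From mathcomp Require Import all_boot all_order all_algebra.
From mathcomp Require Import reals.

Set Implicit Arguments.
Unset Strict Implicit.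
Unset Printing Implicit Defensive.

Import Order.TTheory GRing.Theory Num.Theory.
Local Open Scope ring_scope.

(* d = (H+1)r + Hm, laid out along the partition (state history, input history,
   current state). A history of H blocks of size n has dimension
   [\sum_(i < H) n], the form required by [\mxcol] and [\mxblock]. *)
Definition ext_dim (H r m : nat) : nat :=
  (\sum_(i < H) r + \sum_(i < H) m + r)%N.

Lemma ext_dimE (H r m : nat) : ext_dim H r m = (H.+1 * r + H * m)%N.
Proof. by rewrite /ext_dim !sum_nat_const !card_ord mulSn addnAC [(r + _)%N]addnC. Qed.

Section ExtendedState.

Variables (R : realType) (H r m : nat).

(* [w_{k-H}; ...; w_{k-1}]. Time is integer-valued, so that k - H is never
   truncated. *)
Definition history (n : nat) (w : int -> 'cV[R]_n) (k : int) :
    'cV[R]_(\sum_(i < H) n) :=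
  \mxcol_(i < H) w (k - H%:Z + (i : nat)%:Z).

Definition ext_state (z : int -> 'cV[R]_r) (u : int -> 'cV[R]_m) (k : int) :
    'cV[R]_(ext_dim H r m) :=
  col_mx (col_mx (history z k) (history u k)) (z k).

(* S_z for n = r, S_u for n = m *)
Definition block_shift (n : nat) : 'M[R]_(\sum_(i < H) n, \sum_(i < H) n) :=
  \mxblock_(i < H, j < H) (if (j : nat) == i.+1 then 1%:M else 0 : 'M[R]_n).

(* E_z for n = r; for n = m, the input-history rows [0_{(H-1)m x m}; I_m] of
   beta *)
Definition last_block (n : nat) : 'M[R]_(\sum_(i < H) n, n) :=
  \mxcol_(i < H) (if i.+1 == H then 1%:M else 0 : 'M[R]_n).

Definition ext_shift : 'M[R]_(ext_dim H r m) :=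
  block_mx (block_mx (block_shift r) 0
                     0               (block_shift m)) (col_mx (last_block r) 0)
           (row_mx 0 0)                               0.

Definition ext_alpha (a : 'cV[R]_(ext_dim H r m) -> 'cV[R]_r)
    (xi : 'cV[R]_(ext_dim H r m)) : 'cV[R]_(ext_dim H r m) :=
  ext_shift *m xi + col_mx 0 (a xi).

Definition ext_beta (B : 'cV[R]_(ext_dim H r m) -> 'M[R]_(r, m))
    (xi : 'cV[R]_(ext_dim H r m)) : 'M[R]_(ext_dim H r m, m) :=
  col_mx (col_mx 0 (last_block m)) (B xi).

End ExtendedState.

Definition control_affine (R : realType) (d m : nat)
    (F : 'cV[R]_d -> 'cV[R]_m -> 'cV[R]_d) : Prop :=
  exists (f : 'cV[R]_d -> 'cV[R]_d) (g : 'cV[R]_d -> 'M[R]_(d, m)),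
    forall x v, F x v = f x + g x *m v.

(* Main.v *)
Require Import Defs.
From mathcomp Require Import all_boot all_order all_algebra.
From mathcomp Require Import reals.
From mathcomp Require Import zify.
Import Order.TTheory GRing.Theory Num.Theory.
Local Open Scope ring_scope.

(** The transition is affine in the input by its very form.  For the rest, the
    extended state splits into two histories and a current state, and each
    history is updated by the same rule, whatever its block size: drop the
    oldest block, move the others up by one slot and append the current signal
    ([history_succ]).  The state history receives its new last block from the
    current-state component of the extended state, through the drift; the input
    history receives it from the control term.  The bottom block is the assumed
    recursion for the next latent state. *)

(** In block row [i] of the shift only the block in column [i + 1] is nonzero,
    and it selects the sample at time [k - H + i + 1], which is entry [i] of the
    history at time [k + 1].  The last block row has no superdiagonal block; the
    sample it lacks, at time [k], is exactly the one that [last_block]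
    inserts. *)
Lemma history_succ (R : realType) (H n : nat) (w : int -> 'cV[R]_n) (k : int) :
  block_shift R H n *m history H w k + last_block R H n *m w k
  = history H w (k + 1).
Proof.
rewrite /block_shift /history /last_block mul_mxblock_mxrow mxcol_mul -mxcolD.
apply: eq_mxcol => i.
have [iH|iH] := eqVneq i.+1 H.
- rewrite mul1mx big1 ?add0r => [|j _]; last first.
    by rewrite iH ltn_eqF // mul0mx.
  (* at the last block, i + 1 = H, so that k + 1 - H + i = k *)
  by congr w; lia.
have lt_i1 : (i.+1 < H)%N by rewrite ltn_neqAle iH ltn_ord.
rewrite mul0mx addr0 (bigD1 (Ordinal lt_i1)) //= eqxx mul1mx big1 ?addr0.
  by congr w; lia.
by move=> j /negPf; rewrite -val_eqE /= => ->; rewrite mul0mx.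
Qed.

Theorem proposition2 (R : realType) (H r m : nat)
    (hH : (1 <= H)%N) (hr : (1 <= r)%N) (hm : (1 <= m)%N)
    (a : 'cV[R]_(ext_dim H r m) -> 'cV[R]_r)
    (B : 'cV[R]_(ext_dim H r m) -> 'M[R]_(r, m)) :
  control_affine (fun xi v => ext_alpha a xi + ext_beta B xi *m v) /\
  (forall (z : int -> 'cV[R]_r) (u : int -> 'cV[R]_m) (k : int),
     z (k + 1) = a (ext_state H z u k) + B (ext_state H z u k) *m u k ->
     ext_alpha a (ext_state H z u k) + ext_beta B (ext_state H z u k) *m u k
     = ext_state H z u (k + 1)).
Proof.
split; first by exists (ext_alpha a), (ext_beta B).
move=> z u k z_next; rewrite /ext_alpha /ext_beta.
rewrite [RHS]/ext_state z_next -!history_succ.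
(* the arguments of a and B must stay folded while the block products unfold *)
move: (a _) (B _) => az Bz.
rewrite /ext_shift /ext_state mul_block_col mul_block_col mul_row_col.
rewrite !mul_col_mx !mul0mx !addr0 !add0r.
by rewrite !add_col_mx add0r !addr0 add_col_mx addr0.
Qed.
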